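(* Let $\mathbf s=(s_1,\dots,s_m)\in\mathbf I$ be non-empty. Then $\zeta_u(\mathbf s;z)$ admits a $t$-expansion with coefficients in $A$: there are $c_N\in A$ ($N\ge0$) with $$\zeta_u(\mathbf s;z)=\sum_{N=0}^\infty c_Nt^N\in A[[t]],\qquad t=t(z)=\frac{1}{\exp_{\mathbf C}(\tilde\pi z)},$$ and $c_0=1$ if $m=1$, $c_0=0$ if $m\ge2$.
   Context: Let $r$ be a power of a prime, $A=\mathbb F_r[\theta]$, $K_\infty=\mathbb F_r((1/\theta))$, $\mathbb C_\infty$ the completion of an algebraic closure of $K_\infty$; $A_{+,d}$ the monic polynomials of degree $d$. Carlitz module $a\mapsto\mathbf C_a(X)$ with $\mathbf C_\theta(X)=\theta X+X^r$, Carlitz exponential $\exp_{\mathbf C}$, Carlitz period $\tilde\pi$. $[a]_u=\mathbf C_a(u)/u$. $\mathbf I$: finite tuples of positive integers. $H_d(s;u)=\sum_{a\in A_{+,d}}[a]_u^{-s}$, $H_{<d}(\mathbf s;u)=\sum_{d>d_1>\cdots>d_m\ge0}\prod_jH_{d_j}(s_j;u)$. On $\Omega=\mathbb C_\infty\setminus K_\infty$, $\zeta_u(\mathbf s;z)=\lim_{d\to\infty}H_{<d}(\mathbf s;\exp_{\mathbf C}(\tilde\pi z))$; this is an $A$-periodic rigid analytic function on $\Omega$. A $t$-expansion of such a function is an expansion $\sum_Nc_Nt(z)^N$ valid for $z$ with imaginary part $|z|_i=\inf_{x\in K_\infty}|z-x|_\infty$ sufficiently large. *)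

(* Defs.v *)
From HB Require Import structures.
From mathcomp Require Import all_boot all_order all_algebra.
From mathcomp Require Import all_classical all_reals all_analysis.

Set Implicit Arguments.
Unset Strict Implicit.
Unset Printing Implicit Defensive.

Import Order.TTheory GRing.Theory Num.Theory.
Import numFieldNormedType.Exports.

Local Open Scope classical_set_scope.
Local Open Scope ring_scope.

(* Throughout, A = {poly F} with F = F_r (so r = #|F| and theta = 'X), C is the
   field of values, iota : A -> C the embedding, and v : C -> R the absolute
   value. *)

(** Convergence for the distance (x, y) |-> v (x - y) *)

Definition vcvg (R : realType) (C : fieldType) (v : C -> R)
    (x : nat -> C) (l : C) : Prop :=
  (fun n => v (x n - l) : R) @ \oo --> (0 : R).

Definition vcauchy (R : realType) (C : fieldType) (v : C -> R)
    (x : nat -> C) : Prop :=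
  forall e : R, 0 < e ->
    exists N : nat, forall p q, (N <= p)%N -> (N <= q)%N -> v (x p - x q) < e.

(* 0 if there is no limit; the limit is unique when v is an absolute value. *)
Definition vlim (R : realType) (C : fieldType) (v : C -> R)
    (x : nat -> C) : C :=
  xget 0 [set l | vcvg v x l].

Section Cinfty.
Variables (R : realType) (F : finFieldType) (C : fieldType).
Variables (iota : {rmorphism {poly F} -> C}) (v : C -> R).

Definition theta : C := iota 'X.

(* K_infty = F((1/theta)): the sums of the Laurent series
   \sum_i (c i) theta^(n - i), i >= 0. *)
Definition Kinfty : set C :=
  [set x | exists (n : nat) (c : nat -> F),
    vcvg v (fun N => \sum_(i < N) iota (c i)%:P * (theta ^+ n * theta ^- i)) x].

Definition algebraic_over_Kinfty (x : C) : Prop :=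
  exists p : {poly C}, [/\ p != 0, forall i, Kinfty p`_i & root p x].

(* (C, v) is the completion of an algebraic closure of K_infty, with v the
   absolute value normalised by v theta = r.  Together with algebraic
   closedness of C (a type-level assumption below), this determines C, iota
   and v up to isometric isomorphism: the elements of C algebraic over K_infty
   form an algebraic closure of K_infty, and C is its completion. *)
Record is_Cinfty : Prop := IsCinfty {
  abs_ge0 : forall x, 0 <= v x;
  abs_eq0 : forall x, v x = 0 -> x = 0;
  absM : forall x y, v (x * y) = v x * v y;
  abs_ultrametric : forall x y, v (x + y) <= Num.max (v x) (v y);
  abs_theta : v theta = #|F|%:R;
  abs_complete : forall x, vcauchy v x -> exists l, vcvg v x l;
  abs_dense : forall (x : C) (e : R), 0 < e ->
    exists y, algebraic_over_Kinfty y /\ v (x - y) < e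
}.

Definition Omega : set C := ~` Kinfty.

Definition imag_abs (z : C) : R := inf [set v (z - x) | x in Kinfty].

(** Carlitz module and Carlitz exponential *)

Definition carlitz_theta : {poly {poly F}} := 'X *: 'X + 'X^#|F|.

(* a |-> C_a(X) is the F-algebra morphism from A to the F-linear polynomials
   (multiplied by composition) that sends theta to theta X + X^r. *)
Definition carlitz (a : {poly F}) : {poly {poly F}} :=
  \sum_(i < size a)
    (a`_i)%:P *: iter i (fun P => carlitz_theta \Po P) 'X.

Definition carlitz_eval (a : {poly F}) (u : C) : C :=
  (map_poly iota (carlitz a)).[u].

Definition carlitz_D (i : nat) : C :=
  \prod_(j < i) (theta ^+ (#|F| ^ i) - theta ^+ (#|F| ^ j)).

Definition carlitz_exp (z : C) : C :=
  vlim v (fun n => \sum_(i < n) z ^+ (#|F| ^ i) / carlitz_D i).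

(* A Carlitz period is a generator of the free rank-one A-module
   ker exp_C; it is unique up to a factor in F^*. *)
Definition is_carlitz_period (varpi : C) : Prop :=
  varpi != 0 /\
  forall x, carlitz_exp x = 0 <-> exists a : {poly F}, x = iota a * varpi.

(** Multiple zeta function *)

(* [a]_u = C_a(u) / u, only used for u != 0 *)
Definition carlitz_bracket (a : {poly F}) (u : C) : C := carlitz_eval a u / u.

Definition Hsum (d s : nat) (u : C) : C :=
  \sum_(a : {poly_d.+1 F} |
      ((a : {poly F}) \is monic) && (size (a : {poly F}) == d.+1))
    carlitz_bracket a u ^- s.

Definition Hsum_lt (d m : nat) (s : m.-tuple nat) (u : C) : C :=
  \sum_(e : m.-tuple 'I_d | sorted gtn (map val e))
    \prod_(j < m) Hsum (tnth e j) (tnth s j) u.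

Definition zeta_u (varpi : C) (m : nat) (s : m.-tuple nat) (z : C) : C :=
  vlim v (fun d => Hsum_lt d s (carlitz_exp (varpi * z))).

(** Expansions at infinity *)

Definition t_param (varpi z : C) : C := (carlitz_exp (varpi * z))^-1.

(* f has the t-expansion \sum_N (c N) t^N, with coefficients in A *)
Definition has_t_expansion (varpi : C) (f : C -> C) (c : nat -> {poly F}) : Prop :=
  exists M : R, forall z, Omega z -> M < imag_abs z ->
    vcvg v (fun n => \sum_(N < n) iota (c N) * t_param varpi z ^+ N) (f z).

End Cinfty.

(* Main.v *)
Require Import Defs.
From mathcomp Require Import all_boot all_order all_algebra.
From mathcomp Require Import all_classical all_reals all_analysis.
From mathcomp Require Import finfield ring zify.

Import Order.TTheory GRing.Theory Num.Theory.
Import numFieldNormedType.Exports.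

Set Implicit Arguments.
Unset Strict Implicit.
Unset Printing Implicit Defensive.

Local Open Scope ring_scope.

(* Write q for the cardinal of F.  For a monic of degree d, C_a(X) has total
   degree q^d in (theta, X) and is monic in X, so [a]_u is u^(q^d - 1) times a
   polynomial in t = 1/u with constant term 1 whose coefficient of t^N has degree
   at most N in theta.  Power series with such coefficients converge for
   |u| > q, i.e. q |t| < 1, and are stable under the operations forming the
   multiple sums; as H_d has order at least d in t, the limit zeta_u is again such
   a series, and modulo t it is H_0 = 1 if m = 1 and an empty sum otherwise.

   It remains to see that |exp_C(varpi z)| > q once |z|_i > q / |varpi|.  The
   additive map exp_C sends the disc |w| <= q onto itself, so if
   |exp_C(varpi z)| <= q then varpi z differs from some w in the disc by an
   element a varpi of the kernel, and |z - a| <= q / |varpi|. *)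

(** * Ultrametric absolute value, convergence, and values of polynomials *)

Section UltrametricValue.
Local Open Scope classical_set_scope.
Local Open Scope ring_scope.
Context {R : realType} {F : finFieldType} {C : fieldType}.
Context {iota : {rmorphism {poly F} -> C}} {v : C -> R}.
Hypothesis hC : is_Cinfty iota v.
Local Notation q := (#|F|%:R : R).

Lemma natr_card_gt1 : 1 < q.
Proof. by rewrite ltr1n card_finNzRing_gt1. Qed.

Lemma natr_card_gt0 : 0 < q.
Proof. exact: lt_trans ltr01 natr_card_gt1. Qed.

(** Multiplicativity alone would allow [v 0 = 1]. Since [theta * 0 = 0], the value is fixed under
    multiplication by [q], which differs from 1. *)
Lemma abs0 : v 0 = 0.
Proof.
have h : v 0 * (q - 1) = 0.
  by rewrite mulrBr mulr1 -(abs_theta hC) -(absM hC) mul0r subrr.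
move/eqP: h; rewrite mulf_eq0 subr_eq0 (gt_eqF natr_card_gt1) orbF.
by move/eqP.
Qed.

Lemma abs_eq0E x : (v x == 0) = (x == 0).
Proof. by apply/eqP/eqP => [/(abs_eq0 hC)|->]; rewrite ?abs0. Qed.

Lemma abs_gt0 x : x != 0 -> 0 < v x.
Proof. by move=> x0; rewrite lt_def abs_eq0E x0 (abs_ge0 hC). Qed.

Lemma abs1 : v 1 = 1.
Proof.
have v1 : v 1 != 0 by rewrite abs_eq0E oner_eq0.
by apply: (mulfI v1); rewrite -(absM hC) !mulr1.
Qed.

Lemma absX x n : v (x ^+ n) = v x ^+ n.
Proof. by elim: n => [|n IH]; rewrite ?expr0 ?abs1// !exprS (absM hC) IH. Qed.

Lemma absV x : v x^-1 = (v x)^-1.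
Proof.
have [->|x0] := eqVneq x 0; first by rewrite invr0 abs0 invr0.
have vx0 : v x != 0 by rewrite abs_eq0E.
by apply: (mulfI vx0); rewrite -(absM hC) !divff// abs1.
Qed.

(** Both sides are nonnegative and have the same square. *)
Lemma absN x : v (- x) = v x.
Proof.
apply/eqP; rewrite -(@eqrXn2 _ 2) ?(abs_ge0 hC)//.
by rewrite -!absX sqrrN.
Qed.

Lemma absD_le x y B : v x <= B -> v y <= B -> v (x + y) <= B.
Proof.
by move=> hx hy; apply: le_trans (abs_ultrametric hC x y) _; rewrite ge_max hx.
Qed.

Lemma absB_le x y B : v x <= B -> v y <= B -> v (x - y) <= B.
Proof. by move=> hx hy; apply: absD_le; rewrite ?absN. Qed.

Lemma absD_lt x y B : v x < B -> v y < B -> v (x + y) < B.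
Proof.
by move=> hx hy; apply: le_lt_trans (abs_ultrametric hC x y) _; rewrite gt_max hx.
Qed.

Lemma absB_lt x y B : v x < B -> v y < B -> v (x - y) < B.
Proof. by move=> hx hy; apply: absD_lt; rewrite ?absN. Qed.

Lemma absBC x y : v (x - y) = v (y - x).
Proof. by rewrite -absN opprB. Qed.

Lemma abs_trans_le y x z B : v (x - y) <= B -> v (y - z) <= B -> v (x - z) <= B.
Proof. by move=> h1 h2; rewrite -(subrKA y); apply: absD_le. Qed.

Lemma abs_sum_le I (r : seq I) (P : pred I) (f : I -> C) B : 0 <= B ->
  (forall i, P i -> v (f i) <= B) -> v (\sum_(i <- r | P i) f i) <= B.
Proof.
move=> B0 h; elim/big_rec: _ => [|i x Pi hx]; first by rewrite abs0.
by apply: absD_le hx; exact: h.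
Qed.

Lemma abs_prod I (r : seq I) (P : pred I) (f : I -> C) :
  v (\prod_(i <- r | P i) f i) = \prod_(i <- r | P i) v (f i).
Proof. exact: (big_morph v (absM hC) abs1). Qed.

(** Isosceles triangle principle: if [x - y] were smaller than [y], then [y = x - (x - y)] would be
    smaller than itself. *)
Lemma abs_strict x y : v x < v y -> v (x - y) = v y.
Proof.
move=> xy; apply: le_anti; rewrite absB_le ?(ltW xy)//= leNgt.
apply/negP => h; have : v y < v y.
  by rewrite -{1}[y](subKr x); apply: absB_lt.
by rewrite ltxx.
Qed.

Lemma vcvgP (x : nat -> C) l : vcvg v x l <->
  forall e, 0 < e -> exists N, forall n, (N <= n)%N -> v (x n - l) < e.
Proof.
split=> [/cvgr0Pnorm_lt h e e0|h].
  have [N _ hN] := h e e0; exists N => n Nn.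
  by apply: le_lt_trans (hN n Nn); exact: ler_norm.
apply/cvgr0Pnorm_lt => e e0; have [N hN] := h e e0; exists N => // n /= Nn.
by rewrite ger0_norm ?(abs_ge0 hC)//; exact: hN.
Qed.

(** Closed balls are closed, so an estimate on the tail of a sequence passes to its limit. *)
Lemma vcvg_le (x : nat -> C) l y B N :
  vcvg v x l -> 0 <= B -> (forall n, (N <= n)%N -> v (x n - y) <= B) ->
  v (l - y) <= B.
Proof.
move=> /vcvgP h B0 hN; apply/ler_addgt0Pr => e e0.
have [N' hN'] := h e e0.
pose n := maxn N N'; rewrite -(subrKA (x n)); apply: absD_le.
  by rewrite absBC (le_trans (ltW (hN' n _)))// ?leq_maxr// lerDr.
by rewrite (le_trans (hN n _))// ?leq_maxl// lerDl ltW.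
Qed.

Lemma vcvg_unique {x l l'} : vcvg v x l -> vcvg v x l' -> l = l'.
Proof.
move=> hl /vcvgP hl'; apply/eqP; rewrite -subr_eq0 -abs_eq0E eq_le (abs_ge0 hC).
rewrite andbT; apply/ler_addgt0Pr => e e0; rewrite add0r.
have [N hN] := hl' e e0.
by apply: (vcvg_le hl (ltW e0)) => n /hN/ltW.
Qed.

Lemma vlimE {x l} : vcvg v x l -> vlim v x = l.
Proof.
by move=> h; apply: (vcvg_unique _ h); apply: xgetPex; exists l.
Qed.

(* In an ultrametric space a sequence is Cauchy as soon as consecutive terms get
   close. *)
Lemma vcvg_vlim (x : nat -> C) (b : nat -> R) :
  b @ \oo --> (0 : R) ->
  (\forall n \near \oo, v (x n.+1 - x n) <= b n) -> vcvg v x (vlim v x).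
Proof.
move=> /cvgr0Pnorm_lt hb [N1 _ h1].
suff /(abs_complete hC)[l hl] : vcauchy v x by rewrite (vlimE hl).
move=> e e0; have [N2 _ h2] := hb e e0; pose N := maxn N1 N2.
have hN n : (N <= n)%N -> v (x n - x N) < e.
  elim: n => [|n IH]; first by rewrite leqn0 => /eqP <-; rewrite subrr abs0.
  rewrite leq_eqVlt => /predU1P[<-|Nn]; first by rewrite subrr abs0.
  rewrite -(subrKA (x n)); apply: absD_lt (IH Nn).
  have /= := h1 n (leq_trans (leq_maxl _ _) Nn); move=> /le_lt_trans; apply.
  by apply: le_lt_trans (ler_norm _) (h2 n (leq_trans (leq_maxr _ _) Nn)).
exists N => n k Nn Nk; rewrite -(subrKA (x N)) absD_lt ?hN// absBC; exact: hN.
Qed.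

Lemma vcvgD {x y l k} : vcvg v x l -> vcvg v y k ->
  vcvg v (fun n => x n + y n) (l + k).
Proof.
move=> /vcvgP hx /vcvgP hy; apply/vcvgP => e e0.
have [N1 h1] := hx e e0; have [N2 h2] := hy e e0.
exists (maxn N1 N2) => n; rewrite geq_max => /andP[n1 n2].
rewrite addrAC opprD addrA -addrA [- k + _]addrC absD_lt ?h1// h2//.
Qed.

Lemma vcvg_geometric (x : nat -> C) l (B a : R) : 0 <= a -> a < 1 ->
  (forall n, v (x n - l) <= B * a ^+ n) -> vcvg v x l.
Proof.
move=> a0 a1 h; apply: (@squeeze_cvgr _ _ _ _ (cst 0) (fun n => B * a ^+ n)).
- by apply: nearW => n; rewrite (abs_ge0 hC) h.
- exact: cvg_cst.
- rewrite -[X in _ --> X](mulr0 B); apply: cvgM; first exact: cvg_cst.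
  by apply: cvg_expr; rewrite ger0_norm.
Qed.

(** As [c ^+ #|F| = c], a value above 1 would be strictly increased by taking the power [#|F|]. *)
Lemma abs_poly_const (c : F) : v (iota c%:P) <= 1.
Proof.
rewrite leNgt; apply/negP => h.
have : v (iota c%:P) ^+ #|F| = v (iota c%:P).
  by rewrite -absX -rmorphXn/= -rmorphXn/= expf_card.
move/eqP; rewrite -{2}[v _]expr1 eq_sym; apply/negP.
by rewrite lt_eqF// ltr_eXn2l// card_finNzRing_gt1.
Qed.

Lemma abs_poly_le (a : {poly F}) n : (size a <= n.+1)%N -> v (iota a) <= q ^+ n.
Proof.
move=> sa; rewrite -[a]coefK poly_def raddf_sum/=.
apply: abs_sum_le => [|i _]; first by rewrite exprn_ge0// ltW ?natr_card_gt0.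
rewrite -mul_polyC rmorphM rmorphXn/= (absM hC) absX (abs_theta hC).
apply: le_trans (ler_piMl _ (abs_poly_const _)) _.
  by rewrite exprn_ge0 ?ltW ?natr_card_gt0.
by rewrite ler_weXn2l ?(ltW natr_card_gt1)// -ltnS (leq_trans _ sa).
Qed.

Lemma abs_poly (a : {poly F}) : a != 0 -> v (iota a) = q ^+ (size a).-1.
Proof.
move=> a0; set k := (size a).-1.
have sa : size a = k.+1 by rewrite prednK// lt0n size_poly_eq0.
have lc : lead_coef a != 0 by rewrite lead_coef_eq0.
(* A nonzero constant and its inverse both have value at most 1, with product 1. *)
have v1 : v (iota (lead_coef a)%:P) = 1.
  have e : v (iota (lead_coef a)%:P) * v (iota (lead_coef a)^-1%:P) = 1.
    by rewrite -(absM hC) -rmorphM/= -polyCM divff// rmorph1 abs1.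
  apply: le_anti; rewrite abs_poly_const/= -[leLHS]e.
  by rewrite ler_piMr ?(abs_ge0 hC)// abs_poly_const.
pose l : {poly F} := (lead_coef a)%:P * 'X^k.
have vl : v (iota l) = q ^+ k.
  by rewrite rmorphM rmorphXn/= (absM hC) v1 absX (abs_theta hC) mul1r.
pose b := l - a.
have sb : (size b <= k)%N.
  apply/leq_sizeP => j; rewrite leq_eqVlt coefB coefCM coefXn => /predU1P[<-|kj].
    by rewrite eqxx mulr1 lead_coefE sa subrr.
  by rewrite gtn_eqF// mulr0 sub0r nth_default ?oppr0// sa.
(* The leading term [l] strictly dominates the rest, so [a] has the value of [l]. *)
have vb : v (iota b) < v (iota l).
  rewrite vl; case: (k) sb => [|n sb].
    by rewrite leqn0 size_poly_eq0 => /eqP ->; rewrite rmorph0 abs0.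
  by apply: le_lt_trans (abs_poly_le sb) _; rewrite ltr_eXn2l ?natr_card_gt1.
by rewrite -vl -(abs_strict vb) -rmorphB/= /b addrAC subrr sub0r rmorphN absN.
Qed.

(** Discreteness of A in C turns analytic estimates into exact identities between coefficients. *)
Lemma poly_discrete (a : {poly F}) : v (iota a) < 1 -> a = 0.
Proof.
move=> va; apply: contraTeq va => /abs_poly ->; rewrite -leNgt.
by rewrite exprn_ege1// ltW ?natr_card_gt1.
Qed.

Lemma theta_neq0 : theta iota != 0.
Proof. by rewrite -abs_eq0E (abs_theta hC) gt_eqF// natr_card_gt0. Qed.

(** Makes the distances from [z] to elements of A admissible in the infimum [imag_abs]. *)
Lemma poly_Kinfty (a : {poly F}) : Kinfty iota v (iota a).
Proof.
(* The Laurent series lists the coefficients of [a] from the top. Starting at exponent [size a], one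
   above the degree, makes the term of index 0 vanish and also covers [a = 0]. *)
exists (size a), (fun i => if (i <= size a)%N then a`_(size a - i) else 0).
apply/vcvgP => e e0; exists (size a).+1 => n hn.
rewrite (_ : \sum_(i < n) _ = iota a) ?subrr ?abs0//.
have th0 := theta_neq0.
rewrite -(big_mkord xpredT (fun i => iota (if (i <= size a)%N then
  a`_(size a - i) else 0)%:P * (theta iota ^+ size a * theta iota ^- i))).
rewrite (@big_cat_nat _ _ _ (size a).+1)//= [X in _ + X]big_nat_cond.
rewrite [X in _ + X]big1 ?addr0; last first.
  by move=> i /andP[/andP[+ _] _]; rewrite ltnNge => /negbTE ->;
    rewrite rmorph0 mul0r.
rewrite big_nat_rev/= big_mkord big_ord_recr/=.
rewrite add0n subnn subn0 nth_default// rmorph0 mul0r addr0.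
rewrite -[in RHS](coefK a) poly_def raddf_sum/=; apply: eq_bigr => i _.
rewrite subSS leq_subr subKn 1?ltnW// -mul_polyC rmorphM rmorphXn/=.
by rewrite -exprB ?leq_subr ?unitfE// subKn// ltnW.
Qed.



(** [#|F|] is a power of the characteristic of F, which [iota \o polyC] carries over to C. *)
Lemma exprD_card i (x y : C) : (x + y) ^+ (#|F| ^ i) = x ^+ (#|F| ^ i) + y ^+ (#|F| ^ i).
Proof.
have [p p_pr pF] := finPcharP F.
have pC : p \in [pchar C].
  have := rmorph_pchar (iota \o polyC) pF; exact.
have /= -> := card_pprimeChar pF.
apply: exprDn_pchar; rewrite (eq_pnat _ (pcharf_eq pC)) !pnatX.
by rewrite pnat_id.
Qed.

End UltrametricValue.

(** * Carlitz exponential: convergence, additivity, and its image of a disc *)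

Section CarlitzExponential.
Local Open Scope classical_set_scope.
Local Open Scope ring_scope.
Context {R : realType} {F : finFieldType} {C : fieldType}.
Context {iota : {rmorphism {poly F} -> C}} {v : C -> R}.
Hypothesis hC : is_Cinfty iota v.
Local Notation q := (#|F|%:R : R).
Local Notation q_gt0 := (@natr_card_gt0 R F).
Local Notation q_gt1 := (@natr_card_gt1 R F).
Local Notation exp := (carlitz_exp iota v).

(** In each of the [i] factors the power with exponent [#|F| ^ i] strictly dominates. *)
Lemma abs_carlitz_D i : v (carlitz_D iota i) = q ^+ (i * #|F| ^ i).
Proof.
rewrite /carlitz_D (abs_prod hC) (eq_bigr (fun=> q ^+ (#|F| ^ i))) => [|j _].
  by rewrite prodr_const card_ord -exprM mulnC.
rewrite (absBC hC) (abs_strict hC) ?(absX hC) ?(abs_theta hC)//.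
by rewrite ltr_eXn2l ?q_gt1// ltn_exp2l ?card_finNzRing_gt1.
Qed.

Lemma abs_exp_term z i :
  v (z ^+ (#|F| ^ i) / carlitz_D iota i) = (v z / q ^+ i) ^+ (#|F| ^ i).
Proof.
by rewrite (absM hC) (absV hC) (absX hC) abs_carlitz_D exprM expr_div_n.
Qed.

(** The term is the power [#|F| ^ i] of a number in [0, 1], and the exponent is at least 1. *)
Lemma abs_exp_term_le z i : v z <= q ^+ i ->
  v (z ^+ (#|F| ^ i) / carlitz_D iota i) <= v z / q ^+ i.
Proof.
move=> vz; rewrite abs_exp_term.
have qi0 : 0 < q ^+ i by rewrite exprn_gt0 ?q_gt0.
rewrite -[leRHS]expr1 ler_wiXn2l//.
- by rewrite divr_ge0 ?(abs_ge0 hC) ?ltW.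
- by rewrite ler_pdivrMr// mul1r.
- by rewrite expn_gt0 ?(ltnW (card_finNzRing_gt1 F)).
Qed.

Lemma expr_ge_bound (x : R) : exists k, x <= q ^+ k.
Proof.
have [k hk] : exists k : nat, x <= k%:R.
  by exists (Num.truncn x).+1; apply: ltW; exact: truncnS_gt.
exists k; apply: le_trans hk _; rewrite -natrX ler_nat ltnW// ltn_expl//.
exact: card_finNzRing_gt1.
Qed.

Lemma cvg_geometric_card (B : R) : (fun n => B / q ^+ n) @ \oo --> (0 : R).
Proof.
have -> : (fun n => B / q ^+ n) = (fun n => B * q^-1 ^+ n).
  by apply/funext => n; rewrite exprVn.
rewrite -[X in _ --> X](mulr0 B); apply: cvgM; first exact: cvg_cst.
by apply: cvg_expr; rewrite ger0_norm ?invr_ge0 ?ltW ?q_gt0//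
  invf_lt1 ?q_gt0// q_gt1.
Qed.

Lemma carlitz_exp_cvg z :
  vcvg v (fun n => \sum_(i < n) z ^+ (#|F| ^ i) / carlitz_D iota i) (exp z).
Proof.
have [k hk] := expr_ge_bound (v z).
apply: (vcvg_vlim hC (cvg_geometric_card (v z))); exists k => // n /= kn.
rewrite big_ord_recr/= addrAC subrr add0r abs_exp_term_le// (le_trans hk)//.
by rewrite ler_weXn2l// ltW ?q_gt1.
Qed.

Lemma carlitz_expD z w : exp (z + w) = exp z + exp w.
Proof.
apply: (vcvg_unique hC (carlitz_exp_cvg _)).
have := vcvgD hC (carlitz_exp_cvg z) (carlitz_exp_cvg w).
congr vcvg; apply/funext => n; rewrite -big_split/=; apply: eq_bigr => i _.
by rewrite (exprD_card (iota := iota)) mulrDl.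
Qed.

Lemma carlitz_expB z w : exp (z - w) = exp z - exp w.
Proof. by rewrite -[z in RHS](subrK w) [in RHS]carlitz_expD addrK. Qed.

(** The term of index 0 is [z] itself. On this disc every later term is at most [v z / q]. *)
Lemma carlitz_exp_near z : v z <= q -> v (exp z - z) <= v z / q.
Proof.
move=> vz; apply: (vcvg_le hC (carlitz_exp_cvg z) (N := 1)) => [|[//|n] _].
  by rewrite divr_ge0 ?(abs_ge0 hC)// ltW ?q_gt0.
rewrite big_ord_recl/= /carlitz_D big_ord0 divr1 expn0 expr1 addrAC subrr add0r.
apply: (abs_sum_le hC) => [|i _].
  by rewrite divr_ge0 ?(abs_ge0 hC)// ltW ?q_gt0.
apply: le_trans (abs_exp_term_le _) _.
  by rewrite (le_trans vz)// -[leLHS]expr1 ler_weXn2l ?ltW ?q_gt1.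
rewrite ler_wpM2l ?(abs_ge0 hC)// lef_pV2 ?posrE ?exprn_gt0 ?q_gt0//.
by rewrite -[leLHS]expr1 ler_weXn2l ?ltW ?q_gt1.
Qed.

(* On the disc [v w <= q], [exp] is an additive perturbation [w + E w] of the
   identity with [v (E w) <= v w / q], so the Neumann series
   [\sum_k (- E)^k u] converges to a preimage of [u]. *)
Lemma carlitz_exp_surj u : v u <= q -> exists2 w, v w <= q & exp w = u.
Proof.
move=> vu; pose G x := x - exp x; pose x k := iter k G u.
have vx k : v (x k) <= v u / q ^+ k /\ v (x k) <= q.
  elim: k => [|k [IH1 IH2]]; first by rewrite /= divr1.
  have h : v (x k.+1) <= v (x k) / q by rewrite /= (absBC hC) carlitz_exp_near.
  split; rewrite (le_trans h)//.
    by rewrite exprSr invfM mulrA ler_wpM2r// invr_ge0 ltW ?q_gt0.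
  apply: le_trans IH2; rewrite ler_piMr ?(abs_ge0 hC)//.
  by rewrite invf_le1 ?q_gt0// ltW ?q_gt1.
pose S n := \sum_(k < n) x k; set w := vlim v S.
have S_w : vcvg v S w.
  apply: (vcvg_vlim hC (cvg_geometric_card (v u))); apply: nearW => n.
  by rewrite /S big_ord_recr/= addrAC subrr add0r; case: (vx n).
have vS n : v (S n) <= q.
  by apply: (abs_sum_le hC) => [|k _]; [rewrite ltW ?q_gt0|case: (vx k)].
have vw : v w <= q.
  rewrite -[w]subr0; apply: (vcvg_le hC S_w (N := 0)) => [|n _].
    by rewrite ltW ?q_gt0.
  by rewrite subr0.
(* The sum telescopes, as [exp (x k) = x k - x k.+1]. *)
exists w => //; have expS n : exp (S n) = u - x n.
  elim: n => [|n IH].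
    rewrite /S big_ord0 /= subrr; apply: (vcvg_unique hC (carlitz_exp_cvg 0)).
    apply/(vcvgP hC) => e e0; exists 0%N => n _; rewrite big1 ?subrr ?(abs0 hC)//.
    by move=> i _; rewrite expr0n expn_eq0 gtn_eqF ?mul0r// (ltnW (card_finNzRing_gt1 _)).
  by rewrite /S big_ord_recr/= carlitz_expD IH /G opprB addrA addrAC.
(* Uniqueness of limits for the constant sequence [exp w] reduces the equality to
   [v (exp w - u) < e] for every [e > 0]. *)
apply: (vcvg_unique hC (x := fun=> exp w)).
  by apply/(vcvgP hC) => e e0; exists 0%N => n _; rewrite subrr (abs0 hC).
apply/(vcvgP hC) => e e0.
have /(vcvgP hC)/(_ e e0)[N1 h1] := S_w.
have /cvgr0Pnorm_lt/(_ e e0)[N2 _ h2] := cvg_geometric_card (v u).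
pose n := maxn N1 N2; exists 0%N => _ _.
(* Both terms are small: [S n] tends to [w] and [exp] does not increase values on the disc, while
   [x n] tends to 0. *)
have -> : exp w - u = exp (w - S n) - x n.
  by rewrite carlitz_expB expS; ring.
apply: (absB_lt hC).
  rewrite -[exp _](subrK (w - S n)); have hn := h1 n (leq_maxl _ _).
  rewrite (absBC hC) in hn; apply: (absD_lt hC) => //.
  apply: le_lt_trans hn; apply: le_trans (carlitz_exp_near _) _.
    exact: (absB_le hC).
  by rewrite ler_piMr ?(abs_ge0 hC)// invf_le1 ?q_gt0// ltW ?q_gt1.
apply: le_lt_trans (proj1 (vx n)) _; apply: le_lt_trans (ler_norm _) _.
by apply: h2; rewrite /= leq_maxr.
Qed.

Lemma carlitz_exp_large varpi z : is_carlitz_period iota v varpi ->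
  q / v varpi < imag_abs iota v z -> q < v (exp (varpi * z)).
Proof.
move=> [varpi0 ker_exp] hz; rewrite ltNge; apply/negP => h.
have [w vw ew] := carlitz_exp_surj h.
have /ker_exp[a ha] : exp (varpi * z - w) = 0 by rewrite carlitz_expB ew subrr.
move: hz; rewrite ltNge => /negP; apply.
have vz : v (z - iota a) <= q / v varpi.
  rewrite ler_pdivlMr ?(abs_gt0 hC)// -(absM hC) mulrBl -ha.
  by rewrite [z * _]mulrC subKr.
apply: le_trans vz; apply: ge_inf.
  by exists 0 => _ [y _ <-]; exact: (abs_ge0 hC).
by exists (iota a) => //; exact: poly_Kinfty.
Qed.

End CarlitzExponential.

(** * Functions with a power series expansion in 1/u, with coefficients in A *)

Section Expansion.
Local Open Scope classical_set_scope.
Local Open Scope ring_scope.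
Context {R : realType} {F : finFieldType} {C : fieldType}.
Context {iota : {rmorphism {poly F} -> C}} {v : C -> R}.
Hypothesis hC : is_Cinfty iota v.
Local Notation q := (#|F|%:R : R).
Local Notation q_gt0 := (@natr_card_gt0 R F).
Local Notation q_gt1 := (@natr_card_gt1 R F).
Local Notation tval p u := ((map_poly iota p).[u^-1]).

(** The degree bound gives the term of index [N], evaluated at 1/u, a value of at most
    [(q / v u) ^+ N]. The outer variable plays the role of t. *)
Definition tbounded (p : {poly {poly F}}) := forall N, (size (p`_N)%R <= N.+1)%N.

Lemma tbounded0 : tbounded 0.
Proof. by move=> N; rewrite coef0 size_poly0. Qed.

Lemma tbounded1 : tbounded 1.
Proof. by move=> N; rewrite coef1; case: eqP => _; rewrite ?size_poly1 ?size_poly0. Qed.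

Lemma tboundedX : tbounded 'X.
Proof. by move=> N; rewrite coefX; case: eqP => _; rewrite ?size_poly1 ?size_poly0. Qed.

Lemma tboundedN p : tbounded p -> tbounded (- p).
Proof. by move=> hp N; rewrite coefN size_polyN. Qed.

Lemma tboundedD p r : tbounded p -> tbounded r -> tbounded (p + r).
Proof.
by move=> hp hr N; rewrite coefD (leq_trans (size_polyD _ _))// geq_max hp hr.
Qed.

Lemma tboundedM p r : tbounded p -> tbounded r -> tbounded (p * r).
Proof.
move=> hp hr N; rewrite coefM (leq_trans (size_sum _ _ _))//.
apply/bigmax_leqP => i _; apply: leq_trans (size_polyMleq _ _) _.
by have := ltn_ord i; have := hp i; have := hr (N - i)%N; lia.
Qed.

Definition vanishing n (p : {poly {poly F}}) := forall j, (j < n)%N -> p`_j = 0.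

Lemma rho_ge0 u : 0 <= q / v u.
Proof. by rewrite divr_ge0 ?(abs_ge0 hC) ?ltW ?q_gt0. Qed.

Lemma rho_lt1 u : q < v u -> q / v u < 1.
Proof. by move=> hu; rewrite ltr_pdivrMr ?mul1r// (lt_trans q_gt0). Qed.

Lemma rho_le m n u : q < v u -> (m <= n)%N -> (q / v u) ^+ n <= (q / v u) ^+ m.
Proof. by move=> hu mn; rewrite ler_wiXn2l ?rho_ge0// ltW ?rho_lt1. Qed.

Lemma tval_le n p u : tbounded p -> vanishing n p -> q < v u ->
  v (tval p u) <= (q / v u) ^+ n.
Proof.
move=> bp np hu; rewrite horner_coef.
apply: (abs_sum_le hC) => [|i _]; first by rewrite exprn_ge0 ?rho_ge0.
rewrite coef_map/=; have [/np ->|ni] := ltnP i n.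
  by rewrite rmorph0 mul0r (abs0 hC) exprn_ge0 ?rho_ge0.
apply: le_trans (rho_le hu ni); rewrite (absM hC) (absX hC) (absV hC).
rewrite expr_div_n exprVn ler_wpM2r ?invr_ge0 ?exprn_ge0 ?(abs_ge0 hC)//.
exact: (abs_poly_le hC).
Qed.

(* Encodes, without formal power series, an expansion [\sum_N c_N u^-N] with
   [c_N] in A of degree at most [N] and remainders [(q / v u) ^+ n] on the
   region [q < v u]: closure under products, inverses and limits needs no
   manipulation of coefficients. *)
Definition approximable (f : C -> C) := forall n, exists2 p, tbounded p &
  forall u, q < v u -> v (f u - tval p u) <= (q / v u) ^+ n.

Lemma approximable_ext f g : (forall u, q < v u -> f u = g u) ->
  approximable f -> approximable g.
Proof.
by move=> fg af n; have [p bp hp] := af n; exists p => // u hu; rewrite -fg// hp.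
Qed.

Lemma approximable_tval p : tbounded p -> approximable (fun u => tval p u).
Proof.
by move=> bp n; exists p => // u hu; rewrite subrr (abs0 hC) exprn_ge0 ?rho_ge0.
Qed.

Lemma approximable1 : approximable (fun=> 1).
Proof.
apply: approximable_ext (approximable_tval tbounded1) => u _.
by rewrite rmorph1 hornerC.
Qed.

Lemma approximable0 : approximable (fun=> 0).
Proof.
apply: approximable_ext (approximable_tval tbounded0) => u _.
by rewrite rmorph0 horner0.
Qed.

Lemma approximableV : approximable (fun u => u^-1).
Proof.
apply: approximable_ext (approximable_tval tboundedX) => u _.
by rewrite map_polyX hornerX.
Qed.

Lemma approximableN f : approximable f -> approximable (fun u => - f u).
Proof.
move=> af n; have [p bp hp] := af n; exists (- p); first exact: tboundedN.
by move=> u hu; rewrite rmorphN hornerN -opprD (absN hC) hp.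
Qed.

Lemma approximableD f g : approximable f -> approximable g ->
  approximable (fun u => f u + g u).
Proof.
move=> af ag n; have [p bp hp] := af n; have [r br hr] := ag n.
exists (p + r); first exact: tboundedD.
by move=> u hu; rewrite rmorphD hornerD opprD addrACA (absD_le hC) ?hp ?hr.
Qed.

Lemma approximable_le1 f u : approximable f -> q < v u -> v (f u) <= 1.
Proof.
move=> /(_ 0%N)[p bp hp] hu; rewrite -[f u](subrK (tval p u)) (absD_le hC)//.
  exact: hp.
exact: (@tval_le 0).
Qed.

Lemma approximableM f g : approximable f -> approximable g ->
  approximable (fun u => f u * g u).
Proof.
move=> af ag n; have [p bp hp] := af n; have [r br hr] := ag n.
exists (p * r); first exact: tboundedM.
move=> u hu; rewrite rmorphM hornerM; set P := tval p u; set Q := tval r u.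
(* Both [f u] and [Q] have value at most 1, so multiplication loses no precision. *)
have -> : f u * g u - P * Q = f u * (g u - Q) + Q * (f u - P) by ring.
have le1 (x y : C) : v x <= 1 -> v y <= (q / v u) ^+ n ->
    v (x * y) <= (q / v u) ^+ n.
  move=> x1 y1; rewrite (absM hC) -[leRHS]mul1r.
  by rewrite ler_pM ?(abs_ge0 hC).
apply: (absD_le hC); apply: le1; rewrite ?hp ?hr//.
  exact: approximable_le1.
exact: (@tval_le 0).
Qed.

Lemma approximableX f n : approximable f -> approximable (fun u => f u ^+ n).
Proof.
move=> af; elim: n => [|n IH]; first exact: approximable1.
apply: approximable_ext (approximableM af IH) => u _; by rewrite exprS.
Qed.

Lemma approximable_sum I (r : seq I) (P : pred I) (f : I -> C -> C) :
  (forall i, P i -> approximable (f i)) ->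
  approximable (fun u => \sum_(i <- r | P i) f i u).
Proof.
move=> h; elim: r => [|i r IH].
  by apply: approximable_ext approximable0 => u _; rewrite big_nil.
have [Pi|Pi] := boolP (P i).
  by apply: approximable_ext (approximableD (h i Pi) IH) => u _; rewrite big_cons Pi.
by apply: approximable_ext IH => u _; rewrite big_cons (negbTE Pi).
Qed.

Lemma approximable_prod I (r : seq I) (P : pred I) (f : I -> C -> C) :
  (forall i, P i -> approximable (f i)) ->
  approximable (fun u => \prod_(i <- r | P i) f i u).
Proof.
move=> h; elim: r => [|i r IH].
  by apply: approximable_ext approximable1 => u _; rewrite big_nil.
have [Pi|Pi] := boolP (P i).
  by apply: approximable_ext (approximableM (h i Pi) IH) => u _; rewrite big_cons Pi.
by apply: approximable_ext IH => u _; rewrite big_cons (negbTE Pi).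
Qed.

Lemma approximable_lim f :
  (forall n, exists2 g, approximable g &
    forall u, q < v u -> v (f u - g u) <= (q / v u) ^+ n) ->
  approximable f.
Proof.
move=> h n; have [g /(_ n)[p bp hp] fg] := h n; exists p => // u hu.
by apply: (abs_trans_le hC (y := g u)); rewrite ?fg ?hp.
Qed.


(** Geometric series in [1 - f u]: since [v (f u) = 1], the remainder [(1 - f u) ^+ n / f u] is at
    most [(q / v u) ^+ n]. *)
Lemma approximable_inv f : approximable f ->
  (forall u, q < v u -> v (1 - f u) <= q / v u) ->
  approximable (fun u => (f u)^-1).
Proof.
move=> af f1; apply: approximable_lim => n.
exists (fun u => \sum_(k < n) (1 - f u) ^+ k).
  apply: approximable_sum => k _; apply: approximableX.
  exact: approximableD approximable1 (approximableN af).
move=> u hu; have fu1 : v (f u) = 1.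
  have h : v (1 - f u) < v 1 by rewrite (abs1 hC) (le_lt_trans (f1 u hu))// rho_lt1.
  by rewrite -[RHS](abs1 hC) -(abs_strict hC h) addrAC subrr sub0r (absN hC).
have fu0 : f u != 0 by rewrite -(abs_eq0E hC) fu1 oner_eq0.
have -> : (f u)^-1 - \sum_(k < n) (1 - f u) ^+ k = (1 - f u) ^+ n / f u.
  apply: (mulIf fu0); rewrite mulfVK// mulrBl mulVf//.
  have := subrX1 (1 - f u) n; rewrite addrAC subrr sub0r mulNr.
  move=> e; rewrite [X in _ - X]mulrC -e; ring.
rewrite (absM hC) (absV hC) fu1 invr1 mulr1 (absX hC).
by rewrite lerXn2r ?nnegrE ?(abs_ge0 hC) ?rho_ge0 ?f1.
Qed.

(* Evaluating at the large power [theta ^+ j.+2] isolates the coefficient of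
   index [j], which is then smaller than 1 and hence 0. *)
Lemma vanishing_tval n p : tbounded p ->
  (forall u, q < v u -> v (tval p u) <= (q / v u) ^+ n) -> vanishing n p.
Proof.
move=> bp hp j; elim/ltn_ind: j => j IH jn.
(* By induction [r] has order at least [j.+1], so it is negligible beside the isolated term. *)
pose r := p - p`_j *: 'X^j.
have coef_r i : r`_i = if i == j then 0 else p`_i.
  rewrite coefB coefZ coefXn; case: eqP => [->|_]; first by rewrite mulr1 subrr.
  by rewrite mulr0 subr0.
have br : tbounded r.
  by move=> N; rewrite coef_r; case: eqP; rewrite ?size_poly0.
have zr : vanishing j.+1 r.
  move=> i; rewrite coef_r ltnS leq_eqVlt => /predU1P[->|ij]; first by rewrite eqxx.
  by rewrite (ltn_eqF ij) IH// (ltn_trans ij).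
apply: (poly_discrete hC); pose u : C := theta iota ^+ j.+2.
have vu : v u = q ^+ j.+2 by rewrite (absX hC) (abs_theta hC).
have hu : q < v u by rewrite vu -[ltLHS]expr1 ltr_eXn2l ?q_gt1.
have pj : iota p`_j = (tval p u - tval r u) * u ^+ j.
  rewrite /r rmorphB hornerD hornerN subKr/=.
  rewrite map_polyZ map_polyXn hornerZ hornerXn -mulrA -exprMn mulVf ?expr1n ?mulr1//.
  by rewrite expf_neq0// (theta_neq0 hC).
have vpj : v (iota p`_j) <= (q / v u) ^+ j.+1 * v u ^+ j.
  rewrite pj (absM hC) (absX hC) ler_wpM2r ?exprn_ge0 ?(abs_ge0 hC)//.
  apply: (absB_le hC); last exact: tval_le.
  by apply: le_trans (hp u hu) _; apply: rho_le.
apply: le_lt_trans vpj _.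
have vu0 : 0 < v u by apply: lt_trans hu; exact: q_gt0.
(* The bound simplifies to [q ^+ j.+1 / v u], which is below 1 because [v u = q ^+ j.+2]. *)
rewrite expr_div_n [v u ^+ j.+1]exprSr invfM mulrA mulrAC mulfVK ?expf_neq0 ?gt_eqF//.
by rewrite ltr_pdivrMr// mul1r vu ltr_eXn2l ?q_gt1.
Qed.

Lemma approximable_expansion f : approximable f -> exists c : nat -> {poly F},
  forall u, q < v u -> forall n,
    v (f u - \sum_(N < n) iota (c N) * u^-1 ^+ N) <= (q / v u) ^+ n.
Proof.
move=> af; have /choice[p hp] : forall n, exists p, tbounded p /\
    forall u, q < v u -> v (f u - tval p u) <= (q / v u) ^+ n.
  by move=> n; have [p bp hp] := af n; exists p.
have bp n : tbounded (p n) by case: (hp n).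
have {}hp n : forall u, q < v u -> v (f u - tval (p n) u) <= (q / v u) ^+ n.
  by case: (hp n).
(* [p N.+1] is precise beyond index [N]. A finer approximant [p n] differs from it by at most
   [(q / v w) ^+ N.+1] at every [w] with [q < v w], hence has the same coefficient of index [N]. *)
exists (fun N => (p N.+1)`_N) => u hu n.
have coef_p N : (N < n)%N -> (p N.+1)`_N = (p n)`_N.
  move=> Nn; apply/eqP; rewrite -subr_eq0 -coefB; apply/eqP.
  apply: (@vanishing_tval N.+1) => // [|w hw].
    exact: tboundedD (bp _) (tboundedN (bp _)).
  rewrite rmorphB hornerD hornerN (abs_trans_le hC (y := f w))//.
    by rewrite (absBC hC) hp.
  by rewrite (le_trans (hp _ _ hw))// rho_le.
apply: (abs_trans_le hC (y := tval (p n) u)); first exact: hp.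
(* Truncating [p n] below index [n] changes it by a polynomial of order at least [n], within the
   allowed error. *)
pose c := \poly_(N < n) (p n)`_N.
have -> : \sum_(N < n) iota (p N.+1)`_N * u^-1 ^+ N = tval c u.
  rewrite /c poly_def raddf_sum/= horner_sum; apply: eq_bigr => N _.
  by rewrite map_polyZ map_polyXn hornerZ hornerXn coef_p.
rewrite -hornerN -hornerD -rmorphB; apply: tval_le => //.
  apply: tboundedD (bp _) (tboundedN _) => N; rewrite coef_poly.
  by case: ifP => _; [exact: bp|rewrite size_poly0].
by move=> j jn; rewrite coefB coef_poly jn subrr.
Qed.

End Expansion.

(** * Total degree and leading coefficient of Carlitz polynomials *)

Section CarlitzSums.
Local Open Scope classical_set_scope.
Local Open Scope ring_scope.
Context {R : realType} {F : finFieldType} {C : fieldType}.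
Context {iota : {rmorphism {poly F} -> C}} {v : C -> R}.
Hypothesis hC : is_Cinfty iota v.
Local Notation q := (#|F|%:R : R).
Local Notation q_gt0 := (@natr_card_gt0 R F).
Local Notation q_gt1 := (@natr_card_gt1 R F).
Local Notation approximable := (@approximable R F C iota v).
Local Notation tval p u := ((map_poly iota p).[u^-1]).

(* [P], read as a polynomial in [theta] and [X], has total degree at most [n]. *)
Definition tdeg_le n (P : {poly {poly F}}) :=
  forall j, (size (P`_j)%R <= n.+1 - j)%N.

Lemma tdeg_le_coef n P j : tdeg_le n P -> (n < j)%N -> P`_j = 0.
Proof.
move=> hP nj; apply/eqP; rewrite -size_poly_eq0 -leqn0.
by apply: leq_trans (hP j) _; rewrite leqn0 subn_eq0.
Qed.

Lemma tdeg_leW m n P : (m <= n)%N -> tdeg_le m P -> tdeg_le n P.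
Proof. by move=> mn hP j; rewrite (leq_trans (hP j))// leq_sub2r. Qed.

Lemma tdeg_leD n P Q : tdeg_le n P -> tdeg_le n Q -> tdeg_le n (P + Q).
Proof.
by move=> hP hQ j; rewrite coefD (leq_trans (size_polyD _ _))// geq_max hP hQ.
Qed.

Lemma tdeg_leM m n P Q : tdeg_le m P -> tdeg_le n Q -> tdeg_le (m + n) (P * Q).
Proof.
move=> hP hQ j; rewrite coefM (leq_trans (size_sum _ _ _))//.
apply/bigmax_leqP => i _.
have [mi|mi] := ltnP m i; first by rewrite (tdeg_le_coef hP)// mul0r size_poly0.
have [ni|ni] := ltnP n (j - i).
  by rewrite (tdeg_le_coef hQ)// mulr0 size_poly0.
apply: leq_trans (size_polyMleq _ _) _.
by have := ltn_ord i; have := hP i; have := hQ (j - i)%N; lia.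
Qed.

Lemma tdeg_le_sum n I (r : seq I) (P : pred I) (f : I -> {poly {poly F}}) :
  (forall i, P i -> tdeg_le n (f i)) -> tdeg_le n (\sum_(i <- r | P i) f i).
Proof.
move=> h; elim/big_rec: _ => [j|i x Pi]; first by rewrite coef0 size_poly0.
by apply: tdeg_leD; exact: h.
Qed.

Lemma tdeg_leX n P k : tdeg_le n P -> tdeg_le (k * n) (P ^+ k).
Proof.
move=> hP; elim: k => [|k IH]; last by rewrite exprS mulSn; exact: tdeg_leM.
by move=> [|j]; rewrite expr0 mul0n coef1/= ?size_poly1// size_poly0.
Qed.

Lemma tdeg_leZ m n (a : {poly F}) P : (size a <= m.+1)%N -> tdeg_le n P ->
  tdeg_le (m + n) (a *: P).
Proof.
move=> ha hP; rewrite -mul_polyC; apply: tdeg_leM => // -[|j].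
  by rewrite coefC.
by rewrite coefC size_poly0.
Qed.

Local Notation carlitz_iter i := (iter i (fun P => carlitz_theta F \Po P) 'X).

Lemma carlitz_iterS i :
  carlitz_iter i.+1 = 'X *: carlitz_iter i + carlitz_iter i ^+ #|F|.
Proof. by rewrite /= /carlitz_theta comp_polyD comp_polyZ comp_polyX comp_Xn_poly. Qed.

Lemma tdeg_carlitz_iter i : tdeg_le (#|F| ^ i) (carlitz_iter i).
Proof.
have F1 := card_finNzRing_gt1 F.
elim: i => [|i IH].
  by case=> [|[|j]]; rewrite /= coefX ?size_poly0// size_poly1.
rewrite carlitz_iterS; apply: tdeg_leD; last by rewrite expnS; exact: tdeg_leX.
(* Multiplying by theta costs one degree, which fits since [1 + #|F| ^ i <= 2 * #|F| ^ i <= #|F| ^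
   i.+1]. *)
apply: (@tdeg_leW (1 + #|F| ^ i)); last by apply: tdeg_leZ => //; rewrite size_polyX.
rewrite expnS; apply: leq_trans (leq_mul F1 (leqnn _)).
by rewrite mul2n -addnn leq_add2r expn_gt0 ltnW.
Qed.

(** In the recursion the power [#|F|] of a monic polynomial has strictly larger X-degree than the
    theta-multiple, so monicity persists. *)
Lemma coef_carlitz_iter i : (carlitz_iter i)`_(#|F| ^ i) = 1.
Proof.
have F1 := card_finNzRing_gt1 F.
suff [mon sz] : carlitz_iter i \is monic /\ size (carlitz_iter i) = (#|F| ^ i).+1.
  by have /monicP := mon; rewrite lead_coefE sz.
elim: i => [|i [mon sz]]; first by rewrite /= monicX size_polyX.
have szX : size (carlitz_iter i ^+ #|F|) = (#|F| ^ i.+1).+1.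
  rewrite -[LHS]prednK ?size_exp ?sz ?expnSr//.
  by rewrite size_poly_gt0 monic_neq0// monic_exp.
have szZ : (size ('X *: carlitz_iter i)%R < size (carlitz_iter i ^+ #|F|)%R)%N.
  rewrite szX (leq_ltn_trans (size_scale_leq _ _))// sz ltnS.
  by rewrite ltn_exp2l.
rewrite carlitz_iterS addrC size_polyDl// szX.
by split=> //; rewrite monicE lead_coefDl// -monicE monic_exp.
Qed.

Lemma tdeg_carlitz d (a : {poly F}) : (size a <= d.+1)%N ->
  tdeg_le (#|F| ^ d) (carlitz a).
Proof.
move=> sa; apply: tdeg_le_sum => i _.
apply: (@tdeg_leW (0 + #|F| ^ i)).
  by rewrite add0n leq_exp2l ?card_finNzRing_gt1// -ltnS (leq_trans _ sa).
by apply: tdeg_leZ; [exact: size_polyC_leq1|exact: tdeg_carlitz_iter].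
Qed.

Lemma coef_carlitz d (a : {poly F}) : a \is monic -> size a = d.+1 ->
  (carlitz a)`_(#|F| ^ d) = 1.
Proof.
move=> /monicP; rewrite lead_coefE /carlitz => + sa; rewrite sa => /= ad.
rewrite big_ord_recr/= coefD coef_sum big1 ?add0r => [|i _].
  by rewrite ad scale1r coef_carlitz_iter.
rewrite coefZ (tdeg_le_coef (tdeg_carlitz_iter i)) ?mulr0//.
by rewrite ltn_exp2l ?card_finNzRing_gt1.
Qed.

(* [C_a(X) = X^(q^d) P(1/X)] for [P] the reversed polynomial. *)
Definition carlitz_rev d (a : {poly F}) : {poly {poly F}} :=
  \poly_(k < (#|F| ^ d).+1) (carlitz a)`_(#|F| ^ d - k).

(** Reversal puts the coefficient of [X ^ (#|F| ^ d - k)] at index [k]. Total degree at most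
    [#|F| ^ d] leaves it theta-degree at most [k]. *)
Lemma tbounded_carlitz_rev d (a : {poly F}) : (size a <= d.+1)%N ->
  tbounded (carlitz_rev d a).
Proof.
move=> /tdeg_carlitz ha k; rewrite coef_poly; case: ifP => [|_]; last by rewrite size_poly0.
by move=> hk; have := ha (#|F| ^ d - k)%N; lia.
Qed.

Lemma carlitz_bracketE d (a : {poly F}) u : (size a <= d.+1)%N -> u != 0 ->
  carlitz_bracket iota a u = u ^+ (#|F| ^ d).-1 * tval (carlitz_rev d a) u.
Proof.
move=> sa u0; rewrite /carlitz_bracket /carlitz_eval.
have q0 : (0 < #|F| ^ d)%N by rewrite expn_gt0 ltnW// card_finNzRing_gt1.
apply: (mulIf u0); rewrite mulfVK// mulrAC -exprSr prednK//.
have sz : (size (map_poly iota (carlitz a)) <= (#|F| ^ d).+1)%N.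
  apply/leq_sizeP => j hj; rewrite coef_map/= (tdeg_le_coef (tdeg_carlitz sa))//.
  by rewrite rmorph0.
rewrite (horner_coef_wide _ sz) (@horner_coef_wide _ (#|F| ^ d).+1); last first.
  by rewrite (leq_trans (size_poly _ _))// size_poly.
rewrite mulr_sumr (reindex_inj rev_ord_inj)/=; apply: eq_bigr => i _.
rewrite !coef_map/= coef_poly ltn_ord subSS.
rewrite mulrCA exprVn; congr (_ * _).
by rewrite -exprB ?unitfE// -ltnS.
Qed.

(** * Reciprocals of brackets and the power sums H_d *)

Section HsumTerm.
Variables (d s : nat) (a : {poly F}).
Hypotheses (a_monic : a \is monic) (size_a : size a = d.+1).

(** The constant coefficient of the reversed polynomial is the leading coefficient 1 of C_a, so the
    difference has order at least 1 in 1/u. *)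
Lemma carlitz_rev_near1 u : q < v u -> v (1 - tval (carlitz_rev d a) u) <= q / v u.
Proof.
move=> hu; rewrite (absBC hC) -[q / _]expr1.
have -> : tval (carlitz_rev d a) u - 1 = tval (carlitz_rev d a - 1) u.
  by rewrite rmorphB rmorph1 hornerD hornerN hornerC.
apply: (tval_le hC) => //.
  apply: tboundedD; last by apply: tboundedN; exact: tbounded1.
  by apply: tbounded_carlitz_rev; rewrite size_a.
move=> [|//] _; rewrite coefB coef1 coef_poly/= subn0 coef_carlitz//.
by rewrite subrr.
Qed.

Lemma bracketVE u : q < v u -> carlitz_bracket iota a u ^- s =
  u^-1 ^+ ((#|F| ^ d).-1 * s) * (tval (carlitz_rev d a) u)^-1 ^+ s.
Proof.
move=> hu; rewrite (@carlitz_bracketE d) ?size_a//.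
  by rewrite -exprVn invfM exprMn -exprVn exprM.
by rewrite -(abs_eq0E hC) gt_eqF// (lt_trans q_gt0).
Qed.

Lemma approximable_carlitz_revV :
  approximable (fun u => (tval (carlitz_rev d a) u)^-1).
Proof.
apply: (approximable_inv hC) => [|u]; last exact: carlitz_rev_near1.
by apply: (approximable_tval hC); apply: tbounded_carlitz_rev; rewrite size_a.
Qed.

Lemma approximable_bracketV :
  approximable (fun u => carlitz_bracket iota a u ^- s).
Proof.
apply: (approximable_ext (fun u hu => esym (bracketVE hu))).
apply: (approximableM hC); apply: (approximableX hC).
  exact: (approximableV hC).
exact: approximable_carlitz_revV.
Qed.

Lemma abs_bracketV_le u : (0 < s)%N -> q < v u ->
  v (carlitz_bracket iota a u ^- s) <= (q / v u) ^+ d.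
Proof.
move=> s0 hu; rewrite (bracketVE hu) (absM hC) -[leRHS]mulr1.
rewrite ler_pM ?(abs_ge0 hC)//; last first.
  exact: (approximable_le1 hC (approximableX hC s approximable_carlitz_revV) hu).
(* The factor 1/u occurs to the power [(#|F| ^ d).-1 * s], which is at least [d] because
   [d < #|F| ^ d] and [s] is positive. *)
have dle : (d <= (#|F| ^ d).-1 * s)%N.
  apply: leq_trans (leq_pmulr _ s0).
  by have := ltn_expl d (card_finNzRing_gt1 F); case: (_ ^ _)%N.
apply: le_trans (rho_le hC hu dle).
rewrite (absX hC) (absV hC) lerXn2r ?nnegrE ?invr_ge0 ?(abs_ge0 hC) ?(rho_ge0 hC)//.
by rewrite ler_peMl ?invr_ge0 ?(abs_ge0 hC)// ltW ?q_gt1.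
Qed.
End HsumTerm.

Lemma approximable_Hsum d s : approximable (Hsum iota d s).
Proof.
apply: approximable_ext (fun u _ => erefl) (approximable_sum hC _ _) => a.
move=> /andP[am /eqP sa]; refine (approximable_bracketV _ am sa).
Qed.

Lemma abs_Hsum_le d s u : (0 < s)%N -> q < v u ->
  v (Hsum iota d s u) <= (q / v u) ^+ d.
Proof.
move=> s0 hu; apply: (abs_sum_le hC) => [|a /andP[am /eqP sa]].
  by rewrite exprn_ge0 ?(rho_ge0 hC).
exact: abs_bracketV_le.
Qed.

(** The only monic constant is 1, and its bracket is [u / u]. *)
Lemma Hsum0 s u : u != 0 -> Hsum iota 0 s u = 1.
Proof.
move=> u0; have s1 : (size (1%R : {poly F}) <= 1)%N by rewrite size_poly1.
rewrite /Hsum (big_pred1 (npolyp 1 1)) => [|a].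
  rewrite npolypK//= /carlitz_bracket /carlitz_eval /carlitz size_poly1.
  rewrite big_ord1 coef1/= scale1r map_polyX hornerX divff//.
  by rewrite expr1n invr1.
rewrite /= -(inj_eq val_inj) /= npolypK//; apply/andP/eqP => [[am /eqP sa]|->].
  rewrite (size1_polyC (eq_leq sa)); move/monicP: am.
  by rewrite lead_coefE sa /= => ->.
by rewrite monic1 size_poly1.
Qed.

Lemma approximable_Hsum_lt d m (s : m.-tuple nat) :
  approximable (fun u => Hsum_lt iota d s u).
Proof.
apply: approximable_ext (fun u _ => erefl) (approximable_sum hC _ _) => e _.
apply: (approximable_prod hC _ (f := fun (j : 'I_m) =>
  Hsum iota (tnth e j) (tnth s j))) => j _.
exact: approximable_Hsum.
Qed.

(** * Multiple sums and their limit *)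

Section HsumLt.
Variables (m : nat) (s : m.-tuple nat).
Hypotheses (m_gt0 : (0 < m)%N) (s_gt0 : forall j : 'I_m, (0 < tnth s j)%N).

Lemma Hsum_ltS d u : (0 < d)%N -> Hsum_lt iota d.+1 s u = Hsum_lt iota d s u +
  \sum_(e : m.-tuple 'I_d.+1 | sorted gtn (map val e) && (ord_max \in e))
    \prod_(j < m) Hsum iota (tnth e j) (tnth s j) u.
Proof.
(* Tuples avoiding the largest index correspond to tuples over the smaller ordinal. Positivity of
   the original [d] makes that ordinal inhabited, as [inord] requires; its default value at
   [ord_max] is excluded in [upK]. *)
case: d => // d _; pose up (e : m.-tuple 'I_d.+1) : m.-tuple 'I_d.+2 :=
  map_tuple (widen_ord (leqnSn d.+1)) e.
pose down (e : m.-tuple 'I_d.+2) : m.-tuple 'I_d.+1 := map_tuple (inord \o val) e.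
have downK e : down (up e) = e.
  by apply: eq_from_tnth => j; rewrite !tnth_map /=; apply: val_inj; rewrite /= inordK.
have upK e : ord_max \notin e -> up (down e) = e.
  move=> he; apply: eq_from_tnth => j; rewrite !tnth_map /=; apply: val_inj => /=.
  rewrite inordK// ltn_neqAle -[X in _ && X]ltnS ltn_ord andbT.
  by apply: contraNneq he => ej; apply/tnthP; exists j; apply: val_inj; rewrite /= ej.
have up_max e : ord_max \notin val (up e).
  apply/tnthP => -[j]; rewrite tnth_map => /(congr1 val)/= ej.
  by have := ltn_ord (tnth e j); rewrite -ej ltnn.
rewrite {1}/Hsum_lt (bigID (fun e : m.-tuple _ => ord_max \in e))/= addrC.
congr (_ + _); rewrite (reindex_onto up down) => [|e /andP[_]]; last exact: upK.
apply: eq_big => [e|e _]; last by apply: eq_bigr => j _; rewrite tnth_map.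
by rewrite up_max downK eqxx !andbT -map_comp.
Qed.

(** Every new product contains a factor H_d, of value at most [(q / v u) ^+ d]; the other factors
    have value at most 1. *)
Lemma abs_Hsum_ltS d u : (0 < d)%N -> q < v u ->
  v (Hsum_lt iota d.+1 s u - Hsum_lt iota d s u) <= (q / v u) ^+ d.
Proof.
move=> d0 hu; rewrite Hsum_ltS// addrAC subrr add0r.
apply: (abs_sum_le hC) => [|e /andP[_ /tnthP[j ej]]].
  by rewrite exprn_ge0 ?(rho_ge0 hC).
rewrite (bigD1 j)//= (absM hC) -[leRHS]mulr1 ler_pM ?(abs_ge0 hC)//.
  by rewrite -ej abs_Hsum_le.
apply: (approximable_le1 hC (f := fun u => \prod_(i < m | i != j) _) _ hu).
by apply: (approximable_prod hC _) => i _; exact: approximable_Hsum.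
Qed.

(** All indices are 0, and a constant non-empty tuple is strictly decreasing only when it has length
    1. *)
Lemma Hsum_lt1 u : u != 0 -> Hsum_lt iota 1 s u = (m == 1%N)%:R.
Proof.
move=> u0; rewrite /Hsum_lt.
have e1 (e : m.-tuple 'I_1) : e = [tuple ord0 | j < m].
  by apply: eq_from_tnth => j; rewrite tnth_mktuple ord1.
have -> : (m == 1%N)%:R = \sum_(e : m.-tuple 'I_1 | sorted gtn (map val e)) 1 :> C.
  rewrite (eq_bigl (fun e => (m == 1%N) && (e == [tuple ord0 | j < m]))); last first.
    move=> e; rewrite {2}[e]e1 eqxx andbT.
    case: e {e1} => -[|x [|y t]] /= /eqP em; move: m_gt0; rewrite -em//.
    by rewrite [x]ord1 [y]ord1.
  by case: eqP => _ /=; rewrite ?big_pred1_eq ?big_pred0_eq.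
apply: eq_bigr => e _; rewrite big1// => j _.
by rewrite [tnth e j]ord1 Hsum0.
Qed.

Lemma abs_Hsum_lt_sub d n u : (0 < d)%N -> (d <= n)%N -> q < v u ->
  v (Hsum_lt iota n s u - Hsum_lt iota d s u) <= (q / v u) ^+ d.
Proof.
move=> d0 dn hu; elim: n dn => [|n IH] dn; first by move: d0; rewrite lt0n -leqn0 dn.
move: dn; rewrite leq_eqVlt => /predU1P[<-|dn].
  by rewrite subrr (abs0 hC) exprn_ge0 ?(rho_ge0 hC).
apply: (abs_trans_le hC (y := Hsum_lt iota n s u)); last exact: IH.
by apply: le_trans (abs_Hsum_ltS _ hu) (rho_le hC hu _); rewrite // (leq_trans d0).
Qed.

Let zeta u := vlim v (fun d => Hsum_lt iota d s u).

Lemma abs_zeta_sub d u : (0 < d)%N -> q < v u ->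
  v (zeta u - Hsum_lt iota d s u) <= (q / v u) ^+ d.
Proof.
move=> d0 hu; apply: (vcvg_le hC _ _ (N := d)) => [||n dn].
- apply: (vcvg_vlim hC (b := fun n => (q / v u) ^+ n)).
    by apply: cvg_expr; rewrite ger0_norm ?(rho_ge0 hC)// (rho_lt1 hu).
  by exists 1%N => // n /= n0; exact: abs_Hsum_ltS.
- by rewrite exprn_ge0 ?(rho_ge0 hC).
- exact: abs_Hsum_lt_sub.
Qed.

Lemma zeta_expansion : exists2 c : nat -> {poly F}, c 0%N = (m == 1%N)%:R &
  forall u, q < v u -> forall n,
    v (zeta u - \sum_(N < n) iota (c N) * u^-1 ^+ N) <= (q / v u) ^+ n.
Proof.
have [|c hc] := @approximable_expansion _ _ _ _ _ hC zeta.
  apply: (approximable_lim hC) => n.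
  (* The index [n.+1] is positive even for [n = 0], as [abs_zeta_sub] requires. *)
  exists (Hsum_lt iota n.+1 s) => [|u hu]; first exact: approximable_Hsum_lt.
  apply: le_trans (abs_zeta_sub _ hu) _ => //.
  exact: (rho_le hC hu (leqnSn n)).
(* Both [c 0] and the value of [Hsum_lt] at 1 lie within [q / v u] of [zeta u]. A single point
   [u = theta ^+ 2] of the region makes their difference smaller than 1, hence 0 in A. *)
exists c => //; apply/eqP; rewrite -subr_eq0; apply/eqP/(poly_discrete hC).
pose u := theta iota ^+ 2.
have hu : q < v u.
  by rewrite (absX hC) (abs_theta hC) -[ltLHS]expr1 ltr_eXn2l ?q_gt1.
have u0 : u != 0 by rewrite -(abs_eq0E hC) gt_eqF// (lt_trans q_gt0).
apply: le_lt_trans (rho_lt1 hu); rewrite -[leRHS]expr1 rmorphB rmorph_nat.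
apply: (abs_trans_le hC (y := zeta u)); last first.
  by rewrite -(Hsum_lt1 u0); exact: abs_zeta_sub.
by have := hc u hu 1%N; rewrite big_ord1 expr0 mulr1 (absBC hC).
Qed.

End HsumLt.

End CarlitzSums.

Theorem theorem4p3 (R : realType) (F : finFieldType) (C : closedFieldType)
    (iota : {rmorphism {poly F} -> C}) (v : C -> R) (hC : is_Cinfty iota v)
    (varpi : C) (hvarpi : is_carlitz_period iota v varpi)
    (m : nat) (hm : (0 < m)%N) (s : m.-tuple nat)
    (hs : forall j : 'I_m, (0 < tnth s j)%N) :
  exists c : nat -> {poly F},
    [/\ has_t_expansion iota v varpi (zeta_u iota v varpi s) c,
        m = 1%N -> c 0%N = 1
      & (2 <= m)%N -> c 0%N = 0].
Proof.
have [c c0 hc] := zeta_expansion hC hm hs.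
exists c; split=> [||m2].
- exists (#|F|%:R / v varpi) => z _ hz.
  have hu := carlitz_exp_large hC hvarpi hz.
  apply: (vcvg_geometric hC (rho_ge0 hC _) (rho_lt1 hu) (B := 1)) => n.
  by rewrite mul1r (absBC hC); exact: hc.
- by rewrite c0 => ->.
- by rewrite c0 gtn_eqF.
Qed.
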